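(* A Lorenz dominant allocation among the edge flows of maximum flows need not exist: there is a problem $(G,s,d,u)$ whose set $\mathcal F$ of maximum flows contains no flow $z$ that Lorenz dominates every $z'\in\mathcal F$ (as vectors of edge-flows).
   Context: **Problems and flows.** A problem $(G,s,d,u)$ consists of a finite bipartite graph $G=(S\cup D,E)$ with suppliers $S$, demanders $D$ and edges $E\subseteq S\times D$; supplies $s_i\ge 0$ ($i\in S$), demands $d_j\ge 0$ ($j\in D$), and edge capacities $u_{ij}\in[0,\infty]$. A feasible flow is a vector $z=(z_{ij})_{(i,j)\in E}$ with $0\le z_{ij}\le u_{ij}$, $\sum_{j:(i,j)\in E}z_{ij}\le s_i$ for all $i\in S$, and $\sum_{i:(i,j)\in E}z_{ij}\le d_j$ for all $j\in D$. $\mathcal F$ is the set of maximum flows, i.e. feasible flows maximizing $\sum_{(i,j)\in E}z_{ij}$. **Lorenz dominance.** For $z\in\mathbb R^{E}$, let $z_{(1)}\le z_{(2)}\le\dots\le z_{(|E|)}$ be its coordinates sorted in increasing order. $z$ Lorenz dominates $z'$ if $\sum_{r=1}^{k}z_{(r)}\ge\sum_{r=1}^{k}z'_{(r)}$ for every $k=1,\dots,|E|$. A Lorenz dominant element of $\mathcal F$ is a $z\in\mathcal F$ that Lorenz dominates every $z'\in\mathcal F$. *)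

(* Defs.v *)
From mathcomp Require Import all_boot all_order all_algebra.
From mathcomp Require Import reals constructive_ereal.
Set Implicit Arguments.
Unset Strict Implicit.
Unset Printing Implicit Defensive.
Import Order.TTheory GRing.Theory Num.Theory.
Local Open Scope ring_scope.

(* The two sides of the bipartite graph are distinct types, so they are
   disjoint by construction.  A capacity may be [+oo]. *)
Record problem (R : realType) := Problem {
  supplier : finType;
  demander : finType;
  edges : {set supplier * demander};
  supply : supplier -> R;
  demand : demander -> R;
  capacity : {e : supplier * demander | e \in edges} -> \bar R;
  supply_ge0 : forall i, 0 <= supply i;
  demand_ge0 : forall j, 0 <= demand j;
  capacity_ge0 : forall e, (0 <= capacity e)%E
}.

Definition edge (R : realType) (P : problem R) : finType :=
  {e : supplier P * demander P | e \in edges P}.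

Definition edge_vector (R : realType) (P : problem R) : Type :=
  {ffun edge P -> R}.

Section Flows.
Variables (R : realType) (P : problem R).
Implicit Types z : edge_vector P.

Definition feasible_flow z : Prop :=
  [/\ forall e : edge P, 0 <= z e /\ ((z e)%:E <= capacity e)%E,
      forall i : supplier P,
        \sum_(e : edge P | (val e).1 == i) z e <= supply i
    & forall j : demander P,
        \sum_(e : edge P | (val e).2 == j) z e <= demand j].

Definition flow_value z : R := \sum_(e : edge P) z e.

Definition maximum_flow z : Prop :=
  feasible_flow z /\
  forall z', feasible_flow z' -> flow_value z' <= flow_value z.

Definition increasing_coords z : seq R :=
  sort (fun x y : R => x <= y) [seq z e | e : edge P].

(* [increasing_coords] is indexed from 0: its entry [r] is the coordinate
   usually written z_(r+1). *)
Definition lorenz_dominates z z' : Prop :=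
  forall k : nat, (1 <= k <= #|edge P|)%N ->
    \sum_(0 <= r < k) (increasing_coords z')`_r
      <= \sum_(0 <= r < k) (increasing_coords z)`_r.

Definition lorenz_dominant (F : edge_vector P -> Prop) z : Prop :=
  F z /\ forall z', F z' -> lorenz_dominates z z'.

End Flows.

(* Main.v *)
Require Import Defs.
From mathcomp Require Import all_boot all_order all_algebra.
From mathcomp Require Import reals constructive_ereal.
From mathcomp Require Import lra.

(** The counterexample is the complete bipartite graph on two suppliers and two
demanders with supplies 2, 6, demands 5, 3 and infinite capacities.  Supply and
demand both total 8, so a maximum flow saturates every node and the only
freedom left is to push [t] around the 4-cycle: the maximum flows are

      1 + t   1 - t
      4 - t   2 + t        with -1 <= t <= 1.

The smallest coordinate is at most [1 - |t|], so dominating the flow [t = 0]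
at [k = 1] forces [t = 0] (lemma [maximum_flow_ge1]).  There the sorted
coordinates are 1, 1, 2, 4, whose three smallest add up to 4; but at [t = 1]
they are 0, 2, 3, 3, whose three smallest add up to 5.  At [t = 0] the first
two coordinates move in opposite directions along the cycle, so the third one
alone decides how the sum of three varies, and it increases with [t]. *)

Set Implicit Arguments.
Unset Strict Implicit.
Unset Printing Implicit Defensive.
Import Order.TTheory GRing.Theory Num.Theory.
Local Open Scope ring_scope.

Section SortedCoordinates.
Variables (R : realType) (P : problem R).
Implicit Types z : edge_vector P.

Lemma increasing_coords0_le z (e : edge P) : (increasing_coords z)`_0 <= z e.
Proof.
have: z e \in increasing_coords z by rewrite mem_sort map_f ?mem_enum.
have: sorted <=%R (increasing_coords z) by apply: sort_sorted; exact: le_total.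
case: (increasing_coords z) => [|x s] //= /(order_path_min le_trans)/allP xs.
by rewrite inE => /predU1P[->|/xs].
Qed.

Lemma increasing_coords_perm z (s : seq R) :
  perm_eq [seq z e | e : edge P] s -> sorted <=%R s -> increasing_coords z = s.
Proof.
move=> zs s_sorted; rewrite -[RHS](sorted_sort le_trans s_sorted).
by apply/perm_sortP => //; [exact: le_total|exact: le_trans|exact: le_anti].
Qed.

End SortedCoordinates.

Section Square.
Variable R : realType.

Definition square_supply (i : bool) : R := if i then 2 else 6.
Definition square_demand (j : bool) : R := if j then 5 else 3.

Lemma square_supply_ge0 i : 0 <= square_supply i.
Proof. by case: i; rewrite ler0n. Qed.

Lemma square_demand_ge0 j : 0 <= square_demand j.
Proof. by case: j; rewrite ler0n. Qed.

Definition square : problem R :=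
  @Problem R bool bool [set: bool * bool] square_supply square_demand
    (fun=> +oo%E) square_supply_ge0 square_demand_ge0 (fun=> leey 0%E).

Definition sq_edge (i j : bool) : edge square :=
  exist _ (i, j) (in_setT (i, j)).

Lemma perm_enum_sq_edge :
  perm_eq (enum (edge square))
    [:: sq_edge true true; sq_edge true false;
        sq_edge false true; sq_edge false false].
Proof.
apply: uniq_perm; first exact: enum_uniq.
  by [].
move=> e; rewrite mem_enum !inE -!val_eqE /=.
by case: e => [[[] []] ?].
Qed.

(** Every sum in the definition of a flow unfolds through this lemma into an
explicit sum of at most four terms. *)
Lemma big_sq_edge (Q : pred (edge square)) (F : edge square -> R) :
  \sum_(e | Q e) F e =
  \sum_(e <- [:: sq_edge true true; sq_edge true false;
                 sq_edge false true; sq_edge false false] | Q e) F e.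
Proof. by rewrite -(perm_big _ perm_enum_sq_edge) big_enum_cond. Qed.

Definition cycle_flow (t : R) : edge_vector square :=
  [ffun e : edge square =>
     match val e with
     | (true, true) => 1 + t
     | (true, false) => 1 - t
     | (false, true) => 4 - t
     | (false, false) => 2 + t
     end].

Lemma flow_value_le z : feasible_flow z -> flow_value (P := square) z <= 8.
Proof.
case=> _ zs _; have := zs true; have := zs false.
rewrite /flow_value !big_sq_edge !(big_cons, big_nil) /= /square_supply.
lra.
Qed.

Lemma cycle_flow_maximum t : -1 <= t <= 1 -> maximum_flow (cycle_flow t).
Proof.
move=> /andP[tge tle].
have value8 : flow_value (cycle_flow t) = 8.
  by rewrite /flow_value big_sq_edge !(big_cons, big_nil) /= !ffunE /=; lra.
split; last by move=> z /flow_value_le; rewrite value8.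
split=> [e|i|j].
- by rewrite leey ffunE; case: e => [[[] []] ?] /=; split=> //; lra.
- rewrite big_sq_edge !(big_cons, big_nil) /= /square_supply !ffunE /=.
  by case: i => /=; lra.
- rewrite big_sq_edge !(big_cons, big_nil) /= /square_demand !ffunE /=.
  by case: j => /=; lra.
Qed.

(** A maximum flow is as large as [cycle_flow 0], hence saturates every node.
The two edges at the first supplier then carry 2 in total, so they carry 1
each, and saturation fixes the other two edges. *)
Lemma maximum_flow_ge1 z :
  maximum_flow z -> (forall e, 1 <= z e) -> z = cycle_flow 0.
Proof.
move=> [[_ zs zd] zmax] z1.
have [zf _] : maximum_flow (cycle_flow 0).
  by apply: cycle_flow_maximum; apply/andP; split; lra.
have := zmax _ zf; have := zs true; have := zs false.
have := zd true; have := zd false.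
rewrite /flow_value !big_sq_edge !(big_cons, big_nil) /=.
rewrite /square_supply /square_demand !ffunE /=.
have := z1 (sq_edge true true); have := z1 (sq_edge true false).
move=> *; apply/ffunP => e; rewrite ffunE.
have -> : e = sq_edge (val e).1 (val e).2 by apply: val_inj => /=; case: (val e).
by case: (val e) => [[] []] /=; lra.
Qed.

Lemma perm_cycle_flow t :
  perm_eq [seq cycle_flow t e | e : edge square]
    [:: 1 + t; 1 - t; 4 - t; 2 + t].
Proof.
apply: perm_trans (perm_map _ perm_enum_sq_edge) _.
by rewrite /= !ffunE.
Qed.

Lemma increasing_coords_cycle_flow0 :
  increasing_coords (cycle_flow 0) = [:: 1; 1; 2; 4].
Proof.
apply: increasing_coords_perm; last by rewrite /= lexx ler1n ler_nat.
apply: perm_trans (perm_cycle_flow 0) _.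
rewrite !addr0 !subr0 !perm_cons; exact: permEl (perm_catC [:: 4] [:: 2]).
Qed.

Lemma increasing_coords_cycle_flow1 :
  increasing_coords (cycle_flow 1) = [:: 0; 2; 3; 3].
Proof.
apply: increasing_coords_perm; last by rewrite /= ler0n !ler_nat.
apply: perm_trans (perm_cycle_flow 1) _.
have -> : [:: 1 + 1; 1 - 1; 4 - 1; 2 + 1] = [:: 2; 0; 3; 3] :> seq R.
  by congr [:: _; _; _; _]; lra.
exact: permEl (perm_catCA [:: 2] [:: 0] [:: 3; 3]).
Qed.

Lemma card_sq_edge : #|edge square| = 4.
Proof. by rewrite cardE (perm_size perm_enum_sq_edge). Qed.

End Square.

Theorem proposition2 (R : realType) :
  exists P : problem R,
    ~ exists z : edge_vector P, lorenz_dominant (@maximum_flow R P) z.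
Proof.
exists (square R) => -[z [zmax zdom]].
have z_eq : z = cycle_flow 0.
  apply: maximum_flow_ge1 => // e.
  apply: le_trans (increasing_coords0_le z e).
  have max0 : maximum_flow (cycle_flow (0 : R)).
    by apply: cycle_flow_maximum; apply/andP; split; lra.
  have := zdom _ max0 1%N; rewrite card_sq_edge => /(_ isT).
  by rewrite !big_nat1 increasing_coords_cycle_flow0.
have max1 : maximum_flow (cycle_flow (1 : R)).
  by apply: cycle_flow_maximum; apply/andP; split; lra.
have := zdom _ max1 3%N; rewrite card_sq_edge => /(_ isT).
rewrite z_eq increasing_coords_cycle_flow0 increasing_coords_cycle_flow1.
by rewrite !big_nat_recr ?big_geq //=; lra.
Qed.
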